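(* Let $1\leq m\leq n$ be integers. Let $\pi$ be a parking function chosen uniformly at random from the set of all parking functions of length $n$, and let $C_m(\pi)$ be the number of $m$-cycles of $\pi$. Then the expected number of $m$-cycles is $$\mathbb{E}_n(C_m(\pi))=(m-1)!\,\binom{n+1}{m}\Big/(n+1)^{m}.$$
   Context: A parking function of length $n$ is a sequence $\pi=(\pi_1,\dots,\pi_n)$ of positive integers such that, if $\lambda_1\le\cdots\le\lambda_n$ is the weakly increasing rearrangement of $\pi_1,\dots,\pi_n$, then $\lambda_i\le i$ for all $1\le i\le n$. For $m\ge 1$, distinct indices $(i_1,\dots,i_m)$ in $\{1,\dots,n\}$ form an $m$-cycle of $\pi$ if $\pi_{i_1}=i_2,\ \pi_{i_2}=i_3,\dots,\pi_{i_{m-1}}=i_m,\ \pi_{i_m}=i_1$; tuples that differ by a cyclic rotation are regarded as the same $m$-cycle. For $m=1$ an $m$-cycle is a fixed point. $\mathbb{E}_n$ denotes expectation with respect to the uniform measure on the (finite) set of parking functions of length $n$. *)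

(* Defs.v *)
From HB Require Import structures.
From mathcomp Require Import all_boot all_order all_algebra.
Set Implicit Arguments.
Unset Strict Implicit.
Unset Printing Implicit Defensive.
Import GRing.Theory.

(* The sequence [s] is indexed from 0, so [nth 0 _ i] is the (i+1)-st term. *)
Definition parking (s : seq nat) : bool :=
  all (leq 1) s &&
  all (fun i => nth 0 (sort leq s) i <= i.+1) (iota 0 (size s)).

(* The terms of a parking function of length n are at most n, so storing them
   in 'I_n.+1 = {0, ..., n} loses none; see [parking_functionsP]. *)
Definition parking_functions (n : nat) : {set n.-tuple 'I_n.+1} :=
  [set p : n.-tuple 'I_n.+1 | parking (map val p)].

Lemma parking_le_size (s : seq nat) (x : nat) :
  parking s -> x \in s -> x <= size s.
Proof.
move=> /andP[_ /allP le_s] xs.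
have xS : x \in sort leq s by rewrite mem_sort.
have lt_i : index x (sort leq s) < size s by rewrite -(size_sort leq s) index_mem.
have := le_s (index x (sort leq s)).
rewrite mem_iota add0n lt_i nth_index // => /(_ isT) le_x.
exact: leq_trans le_x lt_i.
Qed.

Lemma parking_functionsP (n : nat) (s : seq nat) :
  reflect (exists2 p, p \in parking_functions n & s = map val p)
          ((size s == n) && parking s).
Proof.
apply: (iffP andP) => [[/eqP sz_s Ps] | [p]]; last first.
  by rewrite inE => Pp ->; rewrite size_map size_tuple.
have sz : size (map (@inord n) s) == n by rewrite size_map sz_s.
have def_s : s = map val (Tuple sz).
  rewrite -map_comp -[LHS]map_id; apply/eq_in_map => x xs /=.
  by rewrite inordK // ltnS -sz_s parking_le_size.
by exists (Tuple sz); rewrite // inE -def_s.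
Qed.

(* An index i in {1, ..., n} is represented by i - 1 : 'I_n, whereas the values
   of p are not shifted: hence the successor on j only. *)
Definition maps_to (n : nat) (p : n.-tuple 'I_n.+1) : rel 'I_n :=
  fun i j => tnth p i == j.+1 :> nat.

Definition cycle_tuples (n m : nat) (p : n.-tuple 'I_n.+1) :
    {set m.-tuple 'I_n} :=
  [set c : m.-tuple 'I_n | uniq c && cycle (maps_to p) c].

Definition rotations (n m : nat) (c : m.-tuple 'I_n) : {set m.-tuple 'I_n} :=
  [set rot_tuple k c | k : 'I_m].

Definition num_cycles (n m : nat) (p : n.-tuple 'I_n.+1) : nat :=
  #|[set rotations c | c in cycle_tuples m p]|.

Definition uniform_expectation (T : finType) (A : {set T}) (X : T -> rat) : rat :=
  ((\sum_(x in A) X x) / #|A|%:R)%R.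

(* Main.v *)
Require Import Defs.
From HB Require Import structures.
From mathcomp Require Import all_boot all_order all_algebra.
From mathcomp Require Import zify ring.

(* Counting pairs (p, c), where c is a listing of an m-cycle of p, gives m times
   the total number of m-cycles.  A permutation of the terms of a parking
   function is a parking function: moving the positions of c to the front turns
   the condition on p into "the first m terms are the rotation of c", so the
   pairs are as many as the parking functions with m distinct first terms.  By
   Pollak's circle argument, each orbit of sequences over Z/(n+1) under
   simultaneous translation contains exactly one parking function; hence a
   translation-invariant set of sequences has exactly a fraction 1/(n+1) of
   parking functions.  This applies to all sequences and to those with m
   distinct first terms. *)

(** * Parking functions through counts of small terms *)

Lemma parking_perm (s1 s2 : seq nat) : perm_eq s1 s2 -> parking s1 = parking s2.
Proof.
move=> s12; rewrite /parking (perm_all _ s12) (perm_size s12).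
by have /(perm_sortP leq_total leq_trans anti_leq) -> := s12.
Qed.

Lemma nth_sorted_leq (s : seq nat) (i x : nat) :
  sorted leq s -> i < size s -> (nth 0 s i <= x) = (i < count (leq^~ x) s).
Proof.
elim: s i => [|y s IHs] i //= ys lt_i.
have le_y : all (leq y) s by apply: order_path_min ys; apply: leq_trans.
have [le_yx | lt_xy] := leqP y x.
  by case: i lt_i => [|i] lt_i //=; rewrite add1n ltnS IHs ?(path_sorted ys).
have lt_s z : z \in y :: s -> (z <= x) = false.
  rewrite inE => /predU1P[-> | /(allP le_y)]; first by rewrite leqNgt lt_xy.
  by move=> le_yz; rewrite leqNgt (leq_trans lt_xy).
rewrite (lt_s _ (mem_nth 0 (lt_i : i < size (y :: s)))) add0n.
rewrite (@eq_in_count _ _ pred0) ?count_pred0 // => z zs.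
by rewrite lt_s // inE zs orbT.
Qed.

(** The i-th smallest term is at most i iff at least i terms are at most i. Only positive terms are
    counted, so the case [k = size s] forces all terms to be positive. *)
Lemma parkingP (s : seq nat) :
  reflect (forall k, k <= size s -> k <= count (fun x => 0 < x <= k) s)
          (parking s).
Proof.
have nth_le i : i < size s ->
    (nth 0 (sort leq s) i <= i.+1) = (i < count (leq^~ i.+1) s).
  move=> lt_i; rewrite nth_sorted_leq ?size_sort ?(sort_sorted leq_total) //.
  by have /permP -> : perm_eq (sort leq s) s by rewrite perm_sort.
apply: (iffP andP) => [[s_gt0 /allP le_s] [|k] // lt_k | le_s].
  have := le_s k; rewrite mem_iota lt_k nth_le // => /(_ isT) le_k.
  rewrite (leq_trans le_k) // (@eq_in_count _ _ (fun x => 0 < x <= k.+1)) //.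
  by move=> x /(allP s_gt0) /= ->.
split; last first.
  apply/allP=> i; rewrite mem_iota /= add0n => lt_i; rewrite nth_le //.
  by apply: leq_trans (le_s _ lt_i) _; apply: sub_count => x /andP[].
rewrite all_count eqn_leq count_size.
by apply: leq_trans (le_s _ (leqnn _)) _; apply: sub_count => x /andP[].
Qed.

(** * Pollak's circle argument *)

(* G j - j decreases by 1 over a period, so in each period exactly one s is such
   that G j - j does not go below its value at s before s + n + 1. *)
Lemma cycle_lemma (n : nat) (G : nat -> nat) :
    (forall j, G (j + n.+1) = G j + n) ->
  #|[set s : 'I_n.+1 | [forall k : 'I_n.+1, G s + k <= G (s + k)]]| = 1.
Proof.
move=> GN.
(* Minimizing w is minimizing G j - j, ties being broken by the least j. *)
pose w (j : 'I_n.+1) := (G j + (n - j)) * n.+1 + j.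
have [s _ s_min] : {s : 'I_n.+1 | true & forall j, w s <= w j}.
  by case: (@arg_minnP _ ord0 predT w) => // s _ s_min; exists s => // j; apply: s_min.
apply/eqP/cards1P; exists s; apply/setP=> s'; rewrite !inE.
have good : forall k : 'I_n.+1, G s + k <= G (s + k).
  move=> k; have := ltn_ord k; have := ltn_ord s.
  have [lt_sk | le_sk] := ltnP (s + k) n.+1.
    have := s_min (Ordinal lt_sk); rewrite /w /=; nia.
  (* The index wraps around to one less than [s]. As ties go to the least index, [s] is strictly
     better there, which absorbs the drop by 1 over a period. *)
  have lt_j : s + k - n.+1 < n.+1 by have := ltn_ord k; have := ltn_ord s; lia.
  have := s_min (Ordinal lt_j); rewrite /w /=.
  have := GN (s + k - n.+1); rewrite subnK // => ->; nia.
apply/forallP/eqP => [good' | -> //]; apply: val_inj.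
wlog: s s' {w s_min} good good' / s < s' => [thm | lt_s].
  by case: (ltngtP s' s) => // lt_s; [rewrite (thm s' s)|rewrite (thm s s')].
have s_lt := ltn_ord s; have s'_lt := ltn_ord s'.
(* Going from [s] to [s'] and on to [s + n.+1] would make [G] grow by at least n + 1 over a
   period. *)
have lt_k : s' - s < n.+1 by lia.
have lt_k' : s + n.+1 - s' < n.+1 by lia.
have := good (Ordinal lt_k); have := good' (Ordinal lt_k') => /=.
have -> : s' + (s + n.+1 - s') = s + n.+1 by lia.
have -> : s + (s' - s) = s' by lia.
rewrite GN; lia.
Qed.

(* Rotates the circle Z/(n+1) so that the point s becomes 1. *)
Definition shift (n : nat) (s x : 'I_n.+1) : 'I_n.+1 := inZp (x.+1 + (n.+1 - s)).

Lemma shift_eqS (n k : nat) (s x : 'I_n.+1) : k < n ->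
  (shift n s x == k.+1 :> nat) = (x == (s + k) %% n.+1 :> nat).
Proof.
move=> lt_k; rewrite /shift /= -[in LHS](@modn_small k.+1 n.+1) //.
rewrite -(eqn_modDr s) -addnA subnK ?(ltnW (ltn_ord s)) // modnDr.
by rewrite addSn [k + s]addnC -addn1 -[(s + k).+1]addn1 eqn_modDr modn_small.
Qed.

Lemma shift_inj (n : nat) (s : 'I_n.+1) : injective (shift n s).
Proof.
move=> x y /(congr1 val)/eqP; rewrite /= eqn_modDr -(addn1 x) -(addn1 y) eqn_modDr.
by rewrite !modn_small // => /eqP/val_inj.
Qed.

(** The points that [shift n s] sends to 1, ..., k form the arc of k points starting at s. *)
Lemma count_shift (n k : nat) (s : 'I_n.+1) (q : seq 'I_n.+1) : k <= n ->
  count (fun x => 0 < x <= k) (map val (map (shift n s) q)) =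
  \sum_(u < k) count_mem ((s + u) %% n.+1) (map val q).
Proof.
elim: k => [|k IHk] lt_k.
  by rewrite big_ord0 (@eq_count _ _ pred0) ?count_pred0 // => x /=; lia.
rewrite big_ord_recr -IHk 1?ltnW //= -[RHS]addnC.
transitivity (count (predU (pred1 k.+1) (fun x => 0 < x <= k))
                    (map val (map (shift n s) q))).
  by apply: eq_count => x /=; lia.
(* The added count of [pred0] stands for the empty intersection in [count_predUI]. *)
rewrite -[LHS]addn0 -[X in _ + X](count_pred0 (map val (map (shift n s) q))).
rewrite (@eq_count _ pred0 (predI (pred1 k.+1) (fun x => 0 < x <= k))); last first.
  by move=> x /=; lia.
rewrite count_predUI; congr (_ + _).
by rewrite !count_map; apply: eq_count => x /=; rewrite -shift_eqS.
Qed.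

Lemma sum_period (N j : nat) (a : nat -> nat) :
  \sum_(v < N) a ((j + v) %% N) = \sum_(v < N) a v.
Proof.
case: N => [|N]; first by rewrite !big_ord0.
elim: j => [|j <-]; first by apply: eq_bigr => v _; rewrite add0n modn_small.
rewrite big_ord_recr [RHS]big_ord_recl /= addnC addn0; congr (_ + _).
  by rewrite addSnnS modnDr.
by apply: eq_bigr => v _; rewrite addSnnS.
Qed.

(** [G j] counts the terms of [q] met in j steps around the circle from 0. By [parkingP], the shift
    by [s] is parking iff [s] is a good start in [cycle_lemma]. *)
Lemma unique_parking_shift (n : nat) (q : n.-tuple 'I_n.+1) :
  #|[set s | map_tuple (shift n s) q \in parking_functions n]| = 1.
Proof.
pose a v := count_mem v (map val q).
pose G j := \sum_(v < j) a (v %% n.+1).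
have GD j k : G (j + k) = G j + \sum_(u < k) a ((j + u) %% n.+1).
  by rewrite /G big_split_ord.
have sum_a : \sum_(v < n.+1) a v = n.
  rewrite /a; under eq_bigr do rewrite -sum1_count.
  rewrite (exchange_big_dep predT) //= big_map -[RHS](size_tuple q) -sum1_size.
  apply: eq_bigr => x _; rewrite (bigD1 x) //= big1 ?addn0 // => y.
  by case/andP=> /eqP/val_inj ->; rewrite eqxx.
rewrite -(@cycle_lemma n G) => [|j]; last by rewrite GD sum_period sum_a.
apply: eq_card => s; rewrite !inE; apply/parkingP/forallP => good k.
  have le_k : k <= n by rewrite -ltnS.
  by rewrite GD leq_add2l -(@count_shift n k s q) // good // !size_map size_tuple.
rewrite !size_map size_tuple => le_k.
by have := good (Ordinal (le_k : k < n.+1)); rewrite GD leq_add2l count_shift.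
Qed.

(** Double count of the pairs (s, q) with q in [A] and its shift by s parking: each q has one s, and
    each s permutes [A]. *)
Lemma card_parking_shift_invariant (n : nat) (A : {set n.-tuple 'I_n.+1}) :
    (forall s q, (map_tuple (shift n s) q \in A) = (q \in A)) ->
  n.+1 * #|A :&: parking_functions n| = #|A|.
Proof.
move=> Ashift; rewrite -[RHS]sum1_card.
under eq_bigr => q _ do rewrite -(unique_parking_shift n q) -sum1_card.
rewrite (exchange_big_dep predT) //= -[X in X * _]card_ord -sum_nat_const.
apply: eq_bigr => s _; rewrite sum1_card.
have inj_s : injective (map_tuple (shift n s) : n.-tuple _ -> _).
  by move=> p q /(congr1 val)/(inj_map (@shift_inj n s))/val_inj.
rewrite -[LHS](on_card_preimset (onW_bij _ (injF_bij inj_s))).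
by apply: eq_card => q; rewrite !inE Ashift unfold_in !inE.
Qed.

(** * Distinct first terms, and rotation classes of cycles *)

Lemma card_uniq_take (T : finType) (m r : nat) :
  #|[set q : (m + r).-tuple T | uniq (take m q)]| = #|T| ^_ m * #|T| ^ r.
Proof.
rewrite -(card_uniq_tuples m T) -(card_tuple r T) -cardsT -cardsX.
pose f (u : m.-tuple T * r.-tuple T) := [tuple of u.1 ++ u.2].
rewrite -(card_imset _ (_ : injective f)); last first.
  move=> [u1 u2] [v1 v2] /(congr1 val)/eqP /=; rewrite eqseq_cat ?size_tuple //.
  by case/andP=> /eqP/val_inj -> /eqP/val_inj ->.
apply: eq_card => q; rewrite inE; apply/idP/imsetP => [Uq | [[u v]]]; last first.
  by rewrite !inE andbT => /andP[_ Uu] ->; rewrite take_size_cat ?size_tuple.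
have sz1 : size (take m q) == m by rewrite size_takel ?size_tuple ?leq_addr.
have sz2 : size (drop m q) == r by rewrite size_drop size_tuple addKn.
exists (Tuple sz1, Tuple sz2); last by apply: val_inj; rewrite /= cat_take_drop.
by rewrite !inE /= Uq all_predT.
Qed.

Lemma rotationsP (n m : nat) (c d : m.+1.-tuple 'I_n) :
  reflect (exists k, val d = rot k c) (d \in rotations c).
Proof.
apply: (iffP imsetP) => [[k _ ->] | [k def_d]]; first by exists k.
have [lt_k | le_k] := ltnP k m.+1; first by exists (Ordinal lt_k) => //; apply: val_inj.
by exists ord0 => //; apply: val_inj; rewrite /= rot0 def_d rot_oversize ?size_tuple.
Qed.

Lemma rotations_rot (n m : nat) (c d : m.+1.-tuple 'I_n) :
  d \in rotations c -> rotations d = rotations c.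
Proof.
have sub (u v : m.+1.-tuple 'I_n) :
    v \in rotations u -> rotations v \subset rotations u.
  move=> /rotationsP[k def_v]; apply/subsetP=> w /rotationsP[j def_w].
  by apply/rotationsP; rewrite def_w def_v rot_rot_add; eexists.
move=> dc; apply/eqP; rewrite eqEsubset !sub //.
have /rotationsP[k def_d] := dc; apply/rotationsP.
by exists (size (rot k c) - k); rewrite def_d; apply/esym/rotK.
Qed.

(** The first entry of [rot k c] is the k-th entry of [c], and these are distinct. *)
Lemma card_rotations (n m : nat) (c : m.+1.-tuple 'I_n) :
  uniq c -> #|rotations c| = m.+1.
Proof.
move=> Uc; rewrite card_imset ?card_ord // => i j /(congr1 val) /= eq_rot.
have nth0_rot (k : 'I_m.+1) : nth (thead c) (rot k c) 0 = nth (thead c) c k.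
  by rewrite /rot nth_cat size_drop size_tuple subn_gt0 ltn_ord nth_drop addn0.
apply/val_inj/eqP; rewrite -(nth_uniq (thead c) _ _ Uc) ?size_tuple ?ltn_ord //.
by rewrite -!nth0_rot eq_rot.
Qed.

(** The fibres of [rotations] on the cycle listings are full rotation classes. *)
Lemma card_cycle_tuples (n m : nat) (p : n.-tuple 'I_n.+1) :
  #|cycle_tuples m.+1 p| = m.+1 * num_cycles m.+1 p.
Proof.
rewrite -sum1_card (partition_big_imset (@rotations n m.+1)) /= mulnC -sum_nat_const.
apply: eq_bigr => _ /imsetP[c c_cyc ->]; rewrite sum1dep_card.
have /setIdP[Uc cyc_c] := c_cyc; rewrite -[RHS](card_rotations n m c Uc).
apply: eq_card => d; rewrite !inE; apply/andP/idP => [[_ /eqP <-] | dc].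
  by apply/rotationsP; exists 0; rewrite rot0.
rewrite (rotations_rot n m c d dc) eqxx.
by have /rotationsP[k ->] := dc; rewrite rot_uniq rot_cycle Uc.
Qed.

(** * Moving a cycle to the front *)

Lemma cycle_map_eq (T : Type) (U : eqType) (f g : T -> U) (c : seq T) :
  cycle (fun x y => f x == g y) c = (map f c == map g (rot 1 c)).
Proof.
case: c => [|x s]; first by rewrite eqxx.
(* Only the current head is generalized; the [x] closing the cycle stays fixed. *)
rewrite rot1_cons /=; elim: s {1 3}x => [|y s IHs] z //=.
by rewrite IHs.
Qed.

Lemma card_parking_cycle (n m : nat) (c : m.-tuple 'I_n) : uniq c ->
  #|[set p in parking_functions n | cycle (maps_to p) c]| =
  #|[set q in parking_functions n |
      take m (map val q) == map (S \o val) (rot 1 c)]|.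
Proof.
move=> Uc.
(* A reordering of the positions in which those of c come first. *)
pose s := c ++ [seq i <- enum 'I_n | i \notin c].
have perm_s : perm_eq s (enum 'I_n).
  apply: uniq_perm => [||i]; rewrite ?enum_uniq //.
    rewrite cat_uniq Uc filter_uniq ?enum_uniq // andbT.
    by apply/hasPn => i; rewrite mem_filter => /andP[].
  by rewrite mem_cat mem_filter mem_enum andbT orbN.
have sz_s : size s == n by rewrite (perm_size perm_s) size_enum_ord.
pose g (p : n.-tuple 'I_n.+1) := map_tuple (tnth p) (Tuple sz_s).
have inj_g : injective g.
  move=> p q /(congr1 val) /= /eq_in_map eq_pq; apply: eq_from_tnth => i.
  by apply: eq_pq; rewrite (perm_mem perm_s) mem_enum.
rewrite -[RHS](on_card_preimset (onW_bij _ (injF_bij inj_g))).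
apply: eq_card => p; rewrite !inE /=; congr (_ && _).
  apply/parking_perm/perm_map; rewrite perm_sym.
  by rewrite -[X in perm_eq _ X](map_tnth_enum p) perm_map.
(* The first m terms of [g p] are the values of [p] along [c]. *)
rewrite -map_take -map_take take_size_cat ?size_tuple // -map_comp.
exact: cycle_map_eq.
Qed.

Lemma card_preimage_rot_succ (n m : nat) (q : n.-tuple 'I_n.+1) :
    0 < n -> m <= n -> q \in parking_functions n ->
  #|[set c : m.-tuple 'I_n |
      uniq c && (take m (map val q) == map (S \o val) (rot 1 c))]| =
  uniq (take m q).
Proof.
case: n q => [|n] q // _ le_mn; rewrite inE => Pq.
pose h (c : seq 'I_n.+1) := map (S \o val) (rot 1 c).
have inj_succ : injective (S \o val : 'I_n.+1 -> nat) by move=> i j [/val_inj].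
have Uh c : uniq (h c) = uniq c by rewrite map_inj_uniq ?rot_uniq.
have Uq : uniq (take m (map val q)) = uniq (take m q).
  by rewrite -map_take (map_inj_uniq val_inj).
have [U | nU] := boolP (uniq (take m q)); last first.
  apply: eq_card0 => c; rewrite inE; apply/andP=> -[Uc /eqP eq_q].
  by case/negP: nU; rewrite -Uq eq_q Uh.
(* The only candidate: undo the successor, then the rotation. Terms of a parking function are
   positive, so the predecessor loses nothing. *)
pose d := rotr 1 [seq inord (val x).-1 : 'I_n.+1 | x <- take m q].
have sz_d : size d == m by rewrite size_rotr size_map size_takel ?size_tuple.
have hd : h d = take m (map val q).
  rewrite /h /d rotrK -map_comp -map_take; apply/eq_in_map => x /mem_take xq /=.
  have x_gt0 : 0 < x by have /andP[/allP q_gt0 _] := Pq; apply/q_gt0/map_f.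
  by rewrite inordK; have := ltn_ord x; lia.
transitivity #|[set Tuple sz_d]|; last by rewrite cards1.
apply: eq_card => c; rewrite !inE -hd.
apply/andP/eqP => [[_ /eqP/(inj_map inj_succ)/rot_inj] eq_d | ->].
  exact/val_inj.
by split; rewrite // -(Uh d) hd Uq.
Qed.

Lemma sum_card_cycle_tuples (n m : nat) : 0 < n -> m <= n ->
  \sum_(p in parking_functions n) #|cycle_tuples m p| =
  #|[set q : n.-tuple 'I_n.+1 | uniq (take m q)] :&: parking_functions n|.
Proof.
move=> n_gt0 le_mn; transitivity (\sum_(c : m.-tuple 'I_n | uniq c)
    #|[set p in parking_functions n | cycle (maps_to p) c]|).
  under eq_bigr do rewrite -sum1_card; under [RHS]eq_bigr do rewrite -sum1dep_card.
  rewrite (exchange_big_dep (fun c : m.-tuple 'I_n => uniq c)) => [|p c _]; last first.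
    by rewrite inE => /andP[].
  by apply: eq_bigr => c Uc; apply: eq_bigl => p; rewrite !inE Uc.
under eq_bigr => c Uc do rewrite (card_parking_cycle n m c Uc) -sum1dep_card.
rewrite (exchange_big_dep [in parking_functions n]) => [|c q _ /andP[] //].
rewrite -sum1_card big_mkcond [RHS]big_mkcond; apply: eq_bigr => q _ /=.
rewrite !inE; case: ifPn => Pq; last by rewrite andbF.
rewrite sum1dep_card andbT.
have := card_preimage_rot_succ n m q n_gt0 le_mn; rewrite inE => /(_ Pq) def_card.
transitivity (uniq (take m q) : nat); last by case: uniq.
by rewrite -def_card; apply: eq_card => c; rewrite !inE Pq.
Qed.

(** * The final count *)

Lemma card_parking_functions (n : nat) :
  n.+1 * #|parking_functions n| = n.+1 ^ n.
Proof.
rewrite -(setTI (parking_functions n)) card_parking_shift_invariant.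
  by rewrite cardsT card_tuple card_ord.
by move=> s q; rewrite !inE.
Qed.

Lemma sum_num_cycles (n m : nat) : 0 < m -> m <= n ->
  (\sum_(p in parking_functions n) num_cycles m p) * n.+1 ^ m =
  (m.-1)`! * 'C(n.+1, m) * #|parking_functions n|.
Proof.
case: m => // m _ le_mn; have n_gt0 : 0 < n by apply: leq_trans le_mn.
have Npf := card_parking_functions n.
have Nuniq : n.+1 * (m.+1 * \sum_(p in parking_functions n) num_cycles m.+1 p) =
    n.+1 ^_ m.+1 * n.+1 ^ (n - m.+1).
  rewrite big_distrr /=; under eq_bigr do rewrite -card_cycle_tuples.
  rewrite sum_card_cycle_tuples // card_parking_shift_invariant => [|s q]; last first.
    by rewrite !inE /= -map_take map_inj_uniq //; apply: shift_inj.
  have := card_uniq_take 'I_n.+1 m.+1 (n - m.+1).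
  by rewrite subnKC // card_ord.
(* The factors [m.+1] and [n.+1] bring in [Nuniq] on the left and, through [Npf], the power
   [n.+1 ^ n] on the right. *)
apply/eqP; rewrite -(eqn_pmul2l (ltn0Sn m)) -(eqn_pmul2l (ltn0Sn n)).
rewrite ![m.+1 * (_ * _)]mulnA [n.+1 * (_ * _)]mulnA Nuniq -bin_ffact factS.
rewrite -mulnA -expnD subnK // -Npf; apply/eqP; rewrite /=; ring.
Qed.

Local Open Scope ring_scope.

Theorem theorem2p4 (n m : nat) (hm : (1 <= m)%N) (hmn : (m <= n)%N) :
  uniform_expectation (parking_functions n) (fun p => (num_cycles m p)%:R) =
    (m.-1)`!%:R * 'C(n.+1, m)%:R / n.+1%:R ^+ m.
Proof.
(* Clearing denominators needs a nonempty sample space. *)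
have pf_gt0 : (0 < #|parking_functions n|)%N.
  by rewrite -(ltn_pmul2l (ltn0Sn n)) muln0 card_parking_functions expn_gt0.
apply/eqP; rewrite /uniform_expectation GRing.eqr_div;
  rewrite ?GRing.expf_neq0 ?Num.Theory.pnatr_eq0 -?lt0n //.
by rewrite -GRing.natr_sum -GRing.natrX -!GRing.natrM sum_num_cycles.
Qed.
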